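(* Let $\mathcal{H}$ be a nonzero complex Hilbert space and let $\sigma$ be a connection on $B(\mathcal{H})^+$. The following are equivalent: (i) $\sigma$ is a mean; (ii) $\|\sigma\|=1$; (iii) $\|A\,\sigma\,A\|=\|A\|$ for all $A\geqslant0$; (iv) $\|A\,\sigma\,A\|=\|A\|$ for some $A>0$.
   Context: $B(\mathcal{H})$ is the algebra of bounded linear operators on $\mathcal{H}$ and $B(\mathcal{H})^+$ its set of positive (semidefinite) operators; $A\geqslant0$ means $A\in B(\mathcal{H})^+$, and $A>0$ means $A$ is positive and invertible. A connection on $B(\mathcal{H})^+$ is a binary operation $\sigma: B(\mathcal{H})^+\times B(\mathcal{H})^+\to B(\mathcal{H})^+$ such that for all $A,B,C,D\geqslant 0$: (M1) $A\leqslant C$, $B\leqslant D$ imply $A\,\sigma\,B\leqslant C\,\sigma\,D$; (M2) $C(A\,\sigma\,B)C\leqslant (CAC)\,\sigma\,(CBC)$; (M3) if $A_n\downarrow A$ and $B_n\downarrow B$ in $B(\mathcal{H})^+$ (decreasing sequences converging strongly), then $A_n\,\sigma\,B_n\downarrow A\,\sigma\,B$. A mean is a connection $\sigma$ with $A\,\sigma\,A=A$ for all $A\geqslant0$. The norm of a connection is $\|\sigma\|=\sup\{\|A\,\sigma\,B\|: A,B\geqslant0,\ \|A\|=\|B\|=1\}$. *)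

(* Defs.v *)
From HB Require Import structures.
From mathcomp Require Import all_boot all_order all_algebra.
From mathcomp Require Import complex ring.
From mathcomp Require Import all_classical all_reals all_analysis.

Set Implicit Arguments.
Unset Strict Implicit.
Unset Printing Implicit Defensive.

Import Order.TTheory GRing.Theory Num.Theory Num.Def.
Import numFieldNormedType.Exports.

Local Open Scope classical_set_scope.
Local Open Scope ring_scope.

(* [inner x y] is linear in x and conjugate-linear in y, see [innerZl] and    *)
(* [innerZr] below.                                                           *)
HB.mixin Record NormedModule_isHilbert (R : realType) (H : Type)
    of NormedModule R[i] H := {
  inner : {dot H for conjC} ;
  sqr_norm_inner : forall x : H, `|x| ^+ 2 = inner x x
}.

#[short(type="hilbertType")]
HB.structure Definition Hilbert (R : realType) :=
  {H of CompleteNormedModule R[i] H & NormedModule_isHilbert R H}.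

Arguments inner {R H} : rename.

Section InnerProduct.
Context {R : realType} {H : hilbertType R}.
Implicit Types (a : R[i]) (x y z : H).

Lemma innerC x y : inner x y = conjC (inner y x).
Proof. by rewrite [LHS]hermitian_subproof expr0 mul1r. Qed.

Lemma innerDl x y z : inner (x + y) z = inner x z + inner y z.
Proof. exact: linearDl. Qed.

Lemma innerZl a x y : inner (a *: x) y = a * inner x y.
Proof. exact: linearZl_LR. Qed.

Lemma innerDr x y z : inner x (y + z) = inner x y + inner x z.
Proof. by rewrite innerC innerDl rmorphD (innerC x y) (innerC x z). Qed.

Lemma innerZr a x y : inner x (a *: y) = conjC a * inner x y.
Proof. by rewrite innerC innerZl rmorphM (innerC x y). Qed.

End InnerProduct.

Section BoundedOperators.
Context {R : realType} {H : hilbertType R}.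

Record bounded_op := BoundedOp {
  bop_fun :> H -> H ;
  bop_linear : linear bop_fun ;
  bop_bounded : exists M : R[i], forall x, `|bop_fun x| <= M * `|x|
}.

HB.instance Definition _ (A : bounded_op) :=
  GRing.isLinear.Build R[i] H H *:%R (bop_fun A) (bop_linear A).

Lemma bounded_op_ext (A B : bounded_op) : A =1 B -> A = B.
Proof.
case: A => f lf bf; case: B => g lg bg /= /funext fg.
move: lf bf lg bg; rewrite fg => *.
by congr BoundedOp; exact: Prop_irrelevance.
Qed.

Lemma comp_linear_proof (A B : bounded_op) : linear (A \o B).
Proof. by move=> a x y /=; rewrite !linearP. Qed.

Lemma comp_bounded_proof (A B : bounded_op) :
  exists M : R[i], forall x, `|(A \o B) x| <= M * `|x|.
Proof.
have [M AM] := bop_bounded A; have [N BN] := bop_bounded B.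
have [x0|/existsNP[x /eqP x0]] := pselect (forall x : H, x = 0).
  by exists 0 => x; rewrite mul0r (x0 (_ x)) normr0.
have M0 : 0 <= M.
  have := le_trans (normr_ge0 _) (AM x).
  by rewrite pmulr_lge0 // normr_gt0.
exists (M * N) => y /=; apply: le_trans (AM _) _.
by rewrite -mulrA ler_wpM2l.
Qed.

Definition comp_op (A B : bounded_op) : bounded_op :=
  BoundedOp (comp_linear_proof A B) (comp_bounded_proof A B).

(* The norm of H is valued in R[i]; taking the real part loses nothing, since 
   norms are nonnegative elements of R[i], hence have zero imaginary part. *)
Definition opnorm (A : bounded_op) : R :=
  sup [set complex.Re `|A x| | x in [set x : H | `|x| <= 1]].

Definition invertible_op (A : bounded_op) : Prop :=
  exists B : bounded_op, cancel A B /\ cancel B A.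

(* [0 <= z] in R[i] means that z is real and nonnegative; over the complex    *)
(* scalars this forces T to be self-adjoint, see [pos_op_selfadj].            *)
Definition psd (T : H -> H) : Prop := forall x, 0 <= inner (T x) x.

Record pos_op := PosOp { pos_val :> bounded_op ; pos_psd : psd pos_val }.

Lemma pos_op_ext (A B : pos_op) : A =1 B -> A = B.
Proof.
case: A => A pA; case: B => B pB /= /bounded_op_ext AB.
move: pA pB; rewrite AB => *.
by congr PosOp; exact: Prop_irrelevance.
Qed.

Definition le_op (A B : pos_op) : Prop := psd (B \- A).

Lemma pos_op_selfadj (A : pos_op) (x y : H) :
  inner (A x) y = inner x (A y).
Proof.
pose f (u v : H) := inner (A u) v - inner u (A v).
have f0 u : f u u = 0.
  rewrite /f [X in _ - X]innerC conj_Creal ?subrr //.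
  by rewrite ger0_real // pos_psd.
have fa a : conjC a * f x y + a * f y x = 0.
  have Axy : A (x + a *: y) = A x + a *: A y.
    by rewrite addrC bop_linear addrC.
  have := f0 (x + a *: y); rewrite /f Axy.
  rewrite !(innerDl, innerDr, innerZl, innerZr) => fxy.
  move: (f0 x) (f0 y); rewrite /f => /subr0_eq fx /subr0_eq fy.
  by rewrite -[RHS]fxy fx fy; ring.
have f1 := fa 1; rewrite conjC1 !mul1r in f1.
have fi := fa 'i; rewrite conjCi mulNr -mulrN -mulrDr in fi.
move/eqP: fi; rewrite mulf_eq0 (negPf (neq0Ci _)) /= => /eqP fi.
have /eqP : 2 * f x y = 0.
  have -> : 2 * f x y = (f x y + f y x) - (- f x y + f y x) by ring.
  by rewrite f1 fi subrr.
by rewrite mulf_eq0 pnatr_eq0 /= => /eqP /subr0_eq.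
Qed.

Lemma congr_op_proof (C A : pos_op) : psd (comp_op C (comp_op A C)).
Proof. by move=> x /=; rewrite pos_op_selfadj; exact: pos_psd. Qed.

(* C A C *)
Definition congr_op (C A : pos_op) : pos_op := PosOp (congr_op_proof C A).

Definition decreases_to (A_ : nat -> pos_op) (A : pos_op) : Prop :=
  (forall m n, (m <= n)%N -> le_op (A_ n) (A_ m)) /\
  (forall x : H, A_ n x @[n --> \oo] --> A x).

Definition is_connection (s : pos_op -> pos_op -> pos_op) : Prop :=
  [/\ forall A B C D : pos_op,
        le_op A C -> le_op B D -> le_op (s A B) (s C D),
      forall A B C : pos_op,
        le_op (congr_op C (s A B)) (s (congr_op C A) (congr_op C B))
    & forall (A_ B_ : nat -> pos_op) (A B : pos_op),
        decreases_to A_ A -> decreases_to B_ B ->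
        decreases_to (fun n => s (A_ n) (B_ n)) (s A B)].

Definition is_mean (s : pos_op -> pos_op -> pos_op) : Prop :=
  is_connection s /\ forall A, s A A = A.

(* Taken in \bar R so that no boundedness is presupposed.                     *)
Definition connection_norm (s : pos_op -> pos_op -> pos_op) : \bar R :=
  ereal_sup [set r | exists A B : pos_op,
    [/\ opnorm A = 1, opnorm B = 1 & r = (opnorm (s A B))%:E]].

End BoundedOperators.

Arguments bounded_op {R} H.
Arguments pos_op {R} H.

(* Main.v *)
(* Everything reduces to [sigma A A = k A] for a constant [k], and no operator
   square root is needed for that. Put [T := sigma I I]. Congruence by
   [v (x) v] gives [<sigma A A v, v> |v|^2 <= <A v, v> <T v, v>], while comparing
   [A] with the rank-one operator [(A x) (x) (A x) / <A x, x>], which is the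
   square of a multiple of itself and lies below [A] by Cauchy-Schwarz, gives
   [<A x, x> <T (A x), A x> <= <sigma A A x, x> |A x|^2].
   For [A = u (x) u] the two bounds show that the Rayleigh quotient of [T] at [u]
   is at most that at any [x] not orthogonal to [u], so it is a constant [k];
   then both bounds together say [sigma A A = k A]. Since [|A| = |B| = 1] implies
   [sigma A B <= sigma I I = k I], the norm of [sigma] is [k]. *)
Require Import Defs.
From HB Require Import structures.
From mathcomp Require Import all_boot all_order all_algebra.
From mathcomp Require Import complex.
From mathcomp Require Import all_classical all_reals all_analysis.
From mathcomp Require Import ring.

Import Order.TTheory GRing.Theory Num.Theory Num.Def.
Import numFieldNormedType.Exports.
Local Open Scope classical_set_scope.
Local Open Scope ring_scope.

(** * Real parts and the order of [R[i]] *)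

Section ComplexRe.
Context {R : realType}.
Implicit Types x y : R[i].

Lemma ler_Re x y : x <= y -> complex.Re x <= complex.Re y.
Proof. by rewrite lecE => /andP[]. Qed.

Lemma ReM_ge0 x y : 0 <= x -> complex.Re (x * y) = complex.Re x * complex.Re y.
Proof.
by case: x => a b; case: y => c d; rewrite lecE /= => /andP[/eqP -> _];
  rewrite mul0r subr0.
Qed.

Lemma ler_Re_ge0 x y : 0 <= x -> 0 <= y ->
  (complex.Re x <= complex.Re y) = (x <= y).
Proof. by rewrite !lecE => /andP[/eqP -> _] /andP[/eqP -> _]; rewrite eqxx. Qed.

End ComplexRe.

(** * Cauchy-Schwarz, antisymmetry of the order, and the scalar and rank-one positive operators *)

Section PositiveOperators.
Context {R : realType} {H : hilbertType R}.
Implicit Types (a c : R[i]) (x y u v : H) (A B C : pos_op H).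

Lemma innerBl x y z : inner (x - y) z = inner x z - inner y z :> R[i].
Proof. by rewrite -scaleN1r innerDl innerZl mulN1r. Qed.

Lemma inner_ge0 x : 0 <= inner x x :> R[i].
Proof. by rewrite -sqr_norm_inner exprn_ge0. Qed.

Lemma inner_gt0 x : x != 0 -> 0 < inner x x :> R[i].
Proof. by move=> x0; rewrite -sqr_norm_inner exprn_gt0 // normr_gt0. Qed.

Lemma inner0l y : inner 0 y = 0 :> R[i].
Proof. by rewrite -(scale0r y) innerZl mul0r. Qed.

Lemma inner0r y : inner y 0 = 0 :> R[i].
Proof. by rewrite innerC inner0l conjC0. Qed.

Lemma le_opP A B : le_op A B <-> forall x, inner (A x) x <= inner (B x) x.
Proof.
by split=> AB x; have := AB x; rewrite /= innerBl subr_ge0.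
Qed.

Lemma bop_add (A : bounded_op H) x y : A (x + y) = A x + A y.
Proof. exact: (linearD A). Qed.

Lemma bop_scale (A : bounded_op H) a x : A (a *: x) = a *: A x.
Proof. exact: (linearZ_LR A). Qed.

Lemma bop0 (A : bounded_op H) : A 0 = 0.
Proof. exact: (linear0 A). Qed.

(** Discriminant argument: positivity of [A] at [x - s b y], with [s] real and [b] the left-hand
    inner product, bounds a quadratic polynomial in [s] from below by 0. *)
Lemma pos_op_CauchySchwarz A x y :
  `|inner (A x) y| ^+ 2 <= inner (A x) x * inner (A y) y.
Proof.
set a := inner (A x) x; set b := inner (A x) y; set d := inner (A y) y.
have a0 : 0 <= a by exact: pos_psd.
have d0 : 0 <= d by exact: pos_psd.
have nb0 : 0 <= `|b| ^+ 2 by exact: exprn_ge0.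
have Ayx : inner (A y) x = b^* by rewrite pos_op_selfadj innerC.
have E s : s \is Num.real ->
    0 <= a - 2 * s * `|b| ^+ 2 + s ^+ 2 * `|b| ^+ 2 * d.
  move=> sr; have := pos_psd A (x + (- (s * b)) *: y).
  rewrite bop_add bop_scale !(innerDl, innerDr, innerZl, innerZr).
  rewrite Ayx -/a -/b -/d rmorphN rmorphM /= (conj_Creal sr) normCK.
  by congr (_ <= _); ring.
have [d_eq0|d_neq0] := eqVneq d 0.
  have [->|b0] := eqVneq b 0; first by rewrite normr0 expr0n mulr_ge0.
  have b2 : 0 < `|b| ^+ 2 by rewrite exprn_gt0 // normr_gt0.
  (* For [d = 0] the polynomial is affine in [s]; this [s] would give it the negative value
     [- (a + 2)]. *)
  have sr : (a + 1) / `|b| ^+ 2 \is Num.real.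
    by rewrite ger0_real // divr_ge0 // addr_ge0.
  have := E _ sr; rewrite d_eq0 mulr0 addr0 -mulrA divfK ?gt_eqF //.
  have -> : a - 2 * (a + 1) = - (a + 2) by ring.
  by rewrite oppr_ge0 lt_geF // ltr_wpDl.
(* [d^-1] minimises the quadratic polynomial. *)
have := E d^-1; rewrite ger0_real ?invr_ge0 // => /(_ isT).
have -> : a - 2 * d^-1 * `|b| ^+ 2 + d^-1 ^+ 2 * `|b| ^+ 2 * d =
    (a * d - `|b| ^+ 2) / d by field.
by rewrite pmulr_lge0 ?subr_ge0 // invr_gt0 lt_def d_neq0.
Qed.

(** Polarization: the quadratic forms of [A] and [B] agree, and testing them at [x + a *: y] for
    [a = 1] and [a = 'i] separates the two cross terms. *)
Lemma le_op_anti A B : le_op A B -> le_op B A -> A = B.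
Proof.
move=> /le_opP AB /le_opP BA.
have q z : inner (A z) z = inner (B z) z by apply: le_anti; rewrite AB BA.
have f0 x y : inner (A x) y = inner (B x) y.
  pose f u v := inner (A u) v - inner (B u) v.
  have fa a : conjC a * f x y + a * f y x = 0.
    have := q (x + a *: y); rewrite !bop_add !bop_scale.
    rewrite !(innerDl, innerDr, innerZl, innerZr) (q x) (q y) /f.
    by move=> /eqP; rewrite -subr_eq0 => /eqP <-; ring.
  have f1 := fa 1; rewrite conjC1 !mul1r in f1.
  have fi := fa 'i; rewrite conjCi mulNr -mulrN -mulrDr in fi.
  move/eqP: fi; rewrite mulf_eq0 (negPf (neq0Ci _)) /= => /eqP fi.
  have /eqP : 2 * f x y = 0.
    have -> : 2 * f x y = (f x y + f y x) - (- f x y + f y x) by ring.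
    by rewrite f1 fi subrr.
  by rewrite mulf_eq0 pnatr_eq0 /= => /eqP /subr0_eq.
apply: pos_op_ext => x; apply/eqP; rewrite -subr_eq0.
apply: contraT => /inner_gt0.
by rewrite innerBl f0 subrr ltxx.
Qed.

Section ScalarOperator.
Variables (a : R[i]) (a0 : 0 <= a).

Lemma scalar_linear : linear (fun x : H => a *: x).
Proof. by move=> c x y; rewrite scalerDr !scalerA mulrC. Qed.

Lemma scalar_bounded : exists M : R[i], forall x : H, `|a *: x| <= M * `|x|.
Proof. by exists `|a| => x; rewrite normrZ. Qed.

Lemma scalar_psd : psd (BoundedOp scalar_linear scalar_bounded).
Proof. by move=> x /=; rewrite innerZl mulr_ge0 // inner_ge0. Qed.

Definition scalar_op : pos_op H := PosOp scalar_psd.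

Lemma scalar_opE x : scalar_op x = a *: x.
Proof. by []. Qed.

End ScalarOperator.

Definition id_op : pos_op H := scalar_op 1 ler01.

Lemma id_opE x : id_op x = x.
Proof. by rewrite scalar_opE scale1r. Qed.

Lemma inner_CauchySchwarz x y : `|inner x y : R[i]| <= `|x| * `|y|.
Proof.
have := pos_op_CauchySchwarz id_op x y; rewrite !id_opE -!sqr_norm_inner.
by rewrite -exprMn ler_pXn2r // nnegrE ?mulr_ge0.
Qed.

Section RankOneOperator.
Variables (a : R[i]) (a0 : 0 <= a) (u : H).

Lemma rank_one_linear : linear (fun x : H => (a * inner x u) *: u).
Proof.
by move=> c x y; rewrite innerDl innerZl mulrDr scalerDl scalerA mulrCA.
Qed.

Lemma rank_one_bounded :
  exists M : R[i], forall x : H, `|(a * inner x u) *: u| <= M * `|x|.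
Proof.
exists (a * `|u| * `|u|) => x; rewrite normrZ normrM (ger0_norm a0).
rewrite -!mulrA ler_wpM2l // [leRHS]mulrCA mulrC ler_wpM2l //.
by rewrite mulrC inner_CauchySchwarz.
Qed.

Lemma rank_one_psd : psd (BoundedOp rank_one_linear rank_one_bounded).
Proof.
move=> x /=; rewrite innerZl [inner u x]innerC -mulrA mulr_ge0 //.
exact: mul_conjC_ge0.
Qed.

Definition rank_one_op : pos_op H := PosOp rank_one_psd.

Lemma rank_one_opE x : rank_one_op x = (a * inner x u) *: u.
Proof. by []. Qed.

End RankOneOperator.

End PositiveOperators.

(** * The operator norm and its relation to the order *)

Section OperatorNorm.
Context {R : realType} {H : hilbertType R}.
Implicit Types (a : R[i]) (x y : H) (A B S : pos_op H).

Let image_nonempty A :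
  [set complex.Re `|A x| | x in [set x : H | `|x| <= 1]] !=set0.
Proof. by exists (complex.Re `|A 0|); exists 0 => //=; rewrite normr0. Qed.

Lemma opnorm_le A a : 0 <= a -> (forall x, `|A x| <= a * `|x|) ->
  opnorm A <= complex.Re a.
Proof.
move=> a0 Aa; apply: ge_sup (image_nonempty A) _ => _ [x /= x1 <-].
by apply/ler_Re/(le_trans (Aa x)); rewrite ler_piMr.
Qed.

Lemma Re_norm_le_opnorm A x : `|x| <= 1 -> complex.Re `|A x| <= opnorm A.
Proof.
move=> x1; apply: ub_le_sup; last by exists x.
(* The bound given by [bop_bounded] is an arbitrary complex number, so it is replaced by its
   modulus. *)
have [m m0 Am] : exists2 m : R[i], 0 <= m & forall y, `|A y| <= m * `|y|.
  have [M AM] := bop_bounded A; exists `|M| => // y.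
  have My : 0 <= M * `|y| by exact: le_trans (AM y).
  by rewrite (le_trans (AM y)) // -(ger0_norm My) normrM normr_id.
exists (complex.Re m) => _ [y /= y1 <-].
by apply/ler_Re/(le_trans (Am y)); rewrite ler_piMr.
Qed.

Lemma opnorm_ge0 A : 0 <= opnorm A.
Proof.
have := @Re_norm_le_opnorm A 0; rewrite bop0 !normr0 /=.
by apply; exact: ler01.
Qed.

Lemma norm_le_opnorm A x : `|A x| <= (opnorm A)%:C%C * `|x|.
Proof.
have [->|x0] := eqVneq x 0; first by rewrite bop0 !normr0 mulr0.
have nx : 0 < `|x| by rewrite normr_gt0.
rewrite -ler_pdivrMr //.
have := @Re_norm_le_opnorm A (`|x|^-1 *: x).
rewrite bop_scale !normrZ normfV normr_id mulVf ?gt_eqF // lexx => /(_ isT).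
by rewrite [`|A x| / _]mulrC -[leLHS]/(complex.Re (_%:C%C)) => h;
  rewrite -ler_Re_ge0 ?mulr_ge0 ?invr_ge0 // lecR opnorm_ge0.
Qed.

(** Cauchy-Schwarz for the form of [S] at [x] and [S x] bounds [|S x|^4] by [(a |x|^2) (a |S x|^2)];
    then [|S x|^2] cancels. *)
Lemma le_scalar_norm S a (a0 : 0 <= a) :
  le_op S (scalar_op a a0) -> forall x, `|S x| <= a * `|x|.
Proof.
move=> /le_opP Sa x.
have [Sx0|Sx0] := eqVneq (S x) 0; first by rewrite Sx0 normr0 mulr_ge0.
have n0 : 0 < `|S x| by rewrite normr_gt0.
have q0 z : 0 <= inner (S z) z by exact: pos_psd.
have /le_trans := pos_op_CauchySchwarz S x (S x).
rewrite -sqr_norm_inner => /(_ ((a * `|x| ^+ 2) * (a * `|S x| ^+ 2))).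
rewrite ler_pM //; last 2 first.
- by have := Sa x; rewrite scalar_opE innerZl sqr_norm_inner.
- by have := Sa (S x); rewrite scalar_opE innerZl sqr_norm_inner.
move=> /(_ isT); rewrite normrX normr_id.
have -> : a * `|x| ^+ 2 * (a * `|S x| ^+ 2) = (a * `|x|) ^+ 2 * `|S x| ^+ 2.
  by ring.
rewrite -exprM (exprD _ 2 2) ler_pM2r ?exprn_gt0 //.
by rewrite ler_pXn2r // nnegrE ?mulr_ge0.
Qed.

Lemma opnorm_le_scalar S a (a0 : 0 <= a) :
  le_op S (scalar_op a a0) -> opnorm S <= complex.Re a.
Proof. by move=> /le_scalar_norm; exact: opnorm_le. Qed.

Lemma le_scalar_opnorm A (a0 : 0 <= (opnorm A)%:C%C) :
  le_op A (scalar_op _ a0).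
Proof.
apply/le_opP => x; rewrite scalar_opE innerZl -sqr_norm_inner expr2 mulrA.
rewrite -[leLHS]ger0_norm; last exact: pos_psd.
apply: le_trans (inner_CauchySchwarz _ _) _.
by rewrite ler_wpM2r ?norm_le_opnorm.
Qed.

Lemma opnorm_scale A B a : 0 <= a -> (forall x, B x = a *: A x) ->
  opnorm B = complex.Re a * opnorm A.
Proof.
(* One inequality suffices: it is applied to [a], then to [a^-1] with the operators exchanged. *)
have le A' B' b : 0 <= b -> (forall x, B' x = b *: A' x) ->
    opnorm B' <= complex.Re b * opnorm A'.
  move=> b0 E; rewrite -[opnorm A']/(complex.Re (opnorm A')%:C%C) -ReM_ge0 //.
  have nA : 0 <= (opnorm A')%:C%C by rewrite lecR opnorm_ge0.
  apply: opnorm_le; first exact: mulr_ge0.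
  by move=> x; rewrite E normrZ ger0_norm // -mulrA ler_wpM2l ?norm_le_opnorm.
move=> a0 E; apply/le_anti; rewrite le //=.
have [->|an0] := eqVneq a 0; first by rewrite mul0r opnorm_ge0.
have : opnorm A <= complex.Re a^-1 * opnorm B.
  by apply: le; [rewrite invr_ge0|move=> x; rewrite E scalerA mulVf ?scale1r].
have Ra : 0 <= complex.Re a by exact: (ler_Re 0 a a0).
move=> /(ler_wpM2l Ra); rewrite mulrA -ReM_ge0 // mulfV //.
by rewrite mul1r.
Qed.

Lemma opnorm_scalar (H0 : exists x : H, x != 0) a (a0 : 0 <= a) :
  opnorm (scalar_op a a0 : pos_op H) = complex.Re a.
Proof.
apply/le_anti/andP; split.
  by apply: opnorm_le => // x; rewrite scalar_opE normrZ ger0_norm.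
have [x x0] := H0.
have := norm_le_opnorm (scalar_op a a0) x.
by rewrite scalar_opE normrZ ger0_norm // ler_pM2r ?normr_gt0 // => /ler_Re.
Qed.

Lemma opnorm_invertible_neq0 (H0 : exists x : H, x != 0) A :
  invertible_op A -> opnorm A != 0.
Proof.
have [x x0] := H0; move=> [B [AB _]]; apply: contraNneq x0 => A0.
have := norm_le_opnorm A x; rewrite A0 mul0r normr_le0 => /eqP Ax.
by rewrite -(AB x) Ax bop0.
Qed.

End OperatorNorm.

(** * Diagonal values of a connection, from monotonicity and the congruence inequality *)

Section Connection.
Context {R : realType} {H : hilbertType R}.
Variable s : pos_op H -> pos_op H -> pos_op H.
Hypothesis s_mono : forall A B C D : pos_op H,
  le_op A C -> le_op B D -> le_op (s A B) (s C D).
Hypothesis s_congr : forall A B C : pos_op H,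
  le_op (congr_op C (s A B)) (s (congr_op C A) (congr_op C B)).
Implicit Types (a : R[i]) (x y u v : H) (A B C : pos_op H).

Let T : pos_op H := s id_op id_op.

Lemma inner_congr_op C A x : inner (congr_op C A x) x = inner (A (C x)) (C x).
Proof. exact: (pos_op_selfadj C (A (C x)) x). Qed.

(** Chains the congruence inequality with monotonicity. The later bounds all come from choosing [A],
    [B] and [C] here. *)
Lemma connection_congr A B C x : le_op (congr_op C A) B ->
  inner (s A A (C x)) (C x) <= inner (s B B x) x.
Proof.
move=> AB; rewrite -inner_congr_op.
have /le_opP/(_ x) := s_mono _ _ _ _ AB AB.
by apply: le_trans; have /le_opP/(_ x) := s_congr A A C.
Qed.

(** For [a > 0], congruence by the scalar [a^(-1/2)] carries [a I] to [I]; only a scalar square root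
    is taken. *)
Lemma connection_scalar_le a (a0 : 0 <= a) x :
  inner (s (scalar_op a a0) (scalar_op a a0) x) x <= a * inner (T x) x.
Proof.
have [a_eq0|a_neq0] := eqVneq a 0.
  rewrite a_eq0 mul0r in a0 *; set Z := scalar_op _ _ : pos_op H.
  (* For [a = 0]: congruence by 2 fixes the zero operator, so [q := <s Z Z x, x>] satisfies
     [4 q <= q], whence [q <= 0]. *)
  have two0 : 0 <= 2 :> R[i] by exact: ler0n.
  have ZZ : le_op (congr_op (scalar_op 2 two0) Z) Z.
    by apply/le_opP => y; rewrite inner_congr_op !scalar_opE !scale0r !inner0l.
  have := connection_congr _ _ _ x ZZ.
  rewrite scalar_opE bop_scale innerZl innerZr conj_Creal ?ger0_real // mulrA.
  rewrite -subr_ge0 -{1}[inner _ _]mul1r -mulrBl.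
  have -> : 1 - 2 * 2 = - 3 :> R[i] by ring.
  by rewrite mulNr oppr_ge0 pmulr_rle0 // ltr0n.
have a_gt0 : 0 < a by rewrite lt_def a_neq0.
have c_gt0 : 0 < sqrtC a by rewrite sqrtC_gt0.
have ci0 : 0 <= (sqrtC a)^-1 by rewrite invr_ge0 ltW.
have cc : (sqrtC a)^-1 * (sqrtC a)^-1 = a^-1 by rewrite -invfM -expr2 sqrtCK.
have aI :
    le_op (congr_op (scalar_op _ ci0) (scalar_op a a0)) (id_op : pos_op H).
  apply/le_opP => y; rewrite inner_congr_op id_opE !scalar_opE.
  rewrite !innerZl innerZr conj_Creal ?ger0_real // [_^-1 * (_^-1 * _)]mulrA cc.
  by rewrite mulVKf.
have := connection_congr _ _ _ x aI.
rewrite scalar_opE bop_scale innerZl innerZr conj_Creal ?ger0_real // mulrA cc.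
by rewrite mulrC ler_pdivrMr // mulrC.
Qed.

Lemma connection_upper A v :
  inner (s A A v) v * inner v v <= inner (A v) v * inner (T v) v.
Proof.
have [->|v0] := eqVneq v 0; first by rewrite !inner0r !(mulr0, mul0r).
have vv := inner_gt0 v v0.
pose C := rank_one_op 1 ler01 v.
have a0 : 0 <= inner (A v) v * inner v v by rewrite mulr_ge0 ?pos_psd ?ltW.
(* [C A C] is [<A v, v>] times [C], and [C] lies below [|v|^2 I] by Cauchy-Schwarz. *)
have Ca : le_op (congr_op C A) (scalar_op _ a0).
  apply/le_opP => y; rewrite inner_congr_op rank_one_opE mul1r scalar_opE.
  rewrite bop_scale !innerZl innerZr mulrA -normCK mulrC -mulrA.
  rewrite ler_wpM2l ?pos_psd //.
  apply: le_trans (_ : (`|y| * `|v|) ^+ 2 <= _).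
    by rewrite ler_pXn2r ?nnegrE ?mulr_ge0 // inner_CauchySchwarz.
  by rewrite exprMn !sqr_norm_inner mulrC.
have := le_trans (connection_congr _ _ _ v Ca) (connection_scalar_le _ a0 v).
rewrite rank_one_opE mul1r bop_scale innerZl innerZr.
rewrite conj_Creal ?(gtr0_real vv) //.
by rewrite [leRHS]mulrAC mulrC ler_pM2r // mulrC.
Qed.

Lemma connection_lower A x :
  inner (A x) x * inner (T (A x)) (A x) <=
  inner (s A A x) x * inner (A x) (A x).
Proof.
set u := A x; set a := inner u x.
have [u0|u0] := eqVneq u 0; first by rewrite u0 !(inner0r, mulr0).
have uu := inner_gt0 u u0.
have a_gt0 : 0 < a.
  rewrite lt_def pos_psd andbT; apply: contraNneq u0 => a0.
  have := pos_op_CauchySchwarz A x u; rewrite -/u -/a a0 mul0r.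
  by rewrite lt_geF // exprn_gt0 // normr_gt0 gt_eqF.
(* The factor [c] makes the square of [C] equal to [a^-1] times the rank-one operator of [u], which
   is the operator lying below [A]. *)
pose c := (sqrtC (a * inner u u))^-1.
have c_gt0 : 0 < c by rewrite invr_gt0 sqrtC_gt0 mulr_gt0.
have cc : c * c = (a * inner u u)^-1 by rewrite -invfM -expr2 sqrtCK.
pose C := rank_one_op c (ltW c_gt0) u.
have CA : le_op (congr_op C id_op) A.
  apply/le_opP => y; rewrite inner_congr_op id_opE rank_one_opE.
  rewrite innerZl innerZr rmorphM /= (conj_Creal (gtr0_real c_gt0)).
  have -> : c * inner y u * (c * conjC (inner y u) * inner u u) =
      c * c * inner u u * (inner y u * conjC (inner y u)) by ring.
  rewrite cc -normCK.
  have -> : (a * inner u u)^-1 * inner u u = a^-1.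
    by field; rewrite !gt_eqF.
  rewrite mulrC ler_pdivrMr // mulrC -norm_conjC -innerC.
  exact: pos_op_CauchySchwarz.
have := connection_congr _ _ _ x CA.
have ux : inner x u = a by rewrite innerC conj_Creal ?gtr0_real.
rewrite rank_one_opE ux bop_scale innerZl innerZr conj_Creal; last first.
  by rewrite gtr0_real ?mulr_gt0.
have -> : c * a * (c * a * inner (T u) u) = c * c * a * a * inner (T u) u.
  by ring.
rewrite cc.
have -> : (a * inner u u)^-1 * a * a * inner (T u) u =
   a * inner (T u) u / inner u u by field; rewrite !gt_eqF.
by rewrite ler_pdivrMr.
Qed.

(** For the rank-one [A] of [u], [A x] is a multiple of [u]. Eliminating [<s A A x, x>] between the
    upper and lower bounds at [x] leaves the claim times [d^2], where [d = |<x, u>|^2] is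
    nonzero. *)
Lemma rayleigh_le x u : inner x u != 0 ->
  inner (T u) u * inner x x <= inner (T x) x * inner u u.
Proof.
move=> b0; pose A := rank_one_op 1 ler01 u.
have u0 : u != 0 by apply: contraNneq b0 => ->; rewrite inner0r.
have x0 : x != 0 by apply: contraNneq b0 => ->; rewrite inner0l.
have uu := inner_gt0 u u0; have xx := inner_gt0 x x0.
have d0 : 0 < inner x u * conjC (inner x u) by rewrite mul_conjC_gt0.
have := connection_lower A x.
have := connection_upper A x.
have -> : A x = inner x u *: u by rewrite /A rank_one_opE mul1r.
rewrite bop_scale !innerZl !innerZr [inner u x]innerC !(mulrA (inner x u)).
set d := _ * _^*; set p := inner (s A A x) x => h1 h2.
have h3 : d * (d * inner (T u) u) * inner x x <=
    p * inner x x * (d * inner u u) by rewrite [leRHS]mulrAC ler_pM2r.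
have := le_trans h3 (ler_wpM2r (ltW (mulr_gt0 d0 uu)) h1).
have -> : d * (d * inner (T u) u) * inner x x =
  d ^+ 2 * (inner (T u) u * inner x x) by ring.
have -> : d * inner (T x) x * (d * inner u u) =
  d ^+ 2 * (inner (T x) x * inner u u) by ring.
by rewrite ler_pM2l // exprn_gt0.
Qed.

Lemma rayleigh_eq x u : x != 0 -> u != 0 ->
  inner (T x) x * inner u u = inner (T u) u * inner x x.
Proof.
have nonorth y v : inner y v != 0 ->
    inner (T y) y * inner v v = inner (T v) v * inner y y.
  move=> yv; apply/le_anti; rewrite !rayleigh_le //.
  by rewrite innerC conjC_eq0.
move=> x0 u0; have [xu|/nonorth//] := eqVneq (inner x u) 0.
have xx := inner_gt0 x x0; have uu := inner_gt0 u u0.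
(* Orthogonal nonzero [x] and [u] are compared through [x + u], which is orthogonal to neither. *)
have w0 : inner (x + u) (x + u) != 0.
  rewrite !(innerDl, innerDr) [inner u x]innerC xu conjC0 addr0 add0r.
  by rewrite gt_eqF // addr_gt0.
have xw : inner x (x + u) != 0 by rewrite innerDr xu addr0 gt_eqF.
have uw : inner u (x + u) != 0.
  by rewrite innerDr innerC xu conjC0 add0r gt_eqF.
apply: (mulIf w0).
have -> : inner (T x) x * inner u u * inner (x + u) (x + u) =
  inner (T x) x * inner (x + u) (x + u) * inner u u by ring.
rewrite (nonorth _ _ xw).
have -> : inner (T u) u * inner x x * inner (x + u) (x + u) =
  inner (T u) u * inner (x + u) (x + u) * inner x x by ring.
by rewrite (nonorth _ _ uw); ring.
Qed.

Lemma connection_diag_scalar (H0 : exists x : H, x != 0) :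
  exists2 k : R[i], 0 <= k & forall A x, s A A x = k *: A x.
Proof.
have [e e0] := H0; have ee := inner_gt0 e e0.
pose k := inner (T e) e / inner e e.
have k0 : 0 <= k by rewrite divr_ge0 ?pos_psd ?ltW.
have Tk x : inner (T x) x = k * inner x x.
  have [->|x0] := eqVneq x 0; first by rewrite !inner0r mulr0.
  rewrite /k mulrAC; apply: (mulIf (lt0r_neq0 ee)).
  by rewrite divfK ?gt_eqF // rayleigh_eq.
have q A x : inner (s A A x) x = k * inner (A x) x.
  have [->|x0] := eqVneq x 0; first by rewrite !inner0r mulr0.
  have xx := inner_gt0 x x0; apply/le_anti/andP; split.
    rewrite -(ler_pM2r xx); apply: le_trans (connection_upper A x) _.
    by rewrite Tk mulrCA mulrA.
  (* When [A x = 0] the lower bound reads [0 <= 0], but the target is then 0 and positivity of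
     [s A A] is enough. *)
  have [Ax0|Ax0] := eqVneq (A x) 0.
    by rewrite Ax0 inner0l mulr0 pos_psd.
  rewrite -(ler_pM2r (inner_gt0 _ Ax0)); apply: le_trans (connection_lower A x).
  by rewrite Tk mulrCA mulrA.
exists k => // A x.
have r0 : 0 <= sqrtC k by rewrite sqrtC_ge0.
(* Congruence by [sqrtC k] realises [k A] as a [pos_op], so that [le_op_anti] applies. *)
pose S := scalar_op (sqrtC k) r0 : pos_op H.
have kE y : congr_op S A y = k *: A y.
  by rewrite /= bop_scale scalerA -expr2 sqrtCK.
suff -> : s A A = congr_op S A by rewrite kE.
by apply: le_op_anti; apply/le_opP => y; rewrite kE innerZl q.
Qed.

End Connection.

(** * The norm of the connection and the cycle of implications *)

Theorem corollary3p4 (R : realType) (H : hilbertType R)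
    (Hneq0 : exists x : H, x != 0)
    (sigma : pos_op H -> pos_op H -> pos_op H)
    (sigma_connection : is_connection sigma) :
  [<-> is_mean sigma;
       connection_norm sigma = 1%E;
       forall A : pos_op H, opnorm (sigma A A) = opnorm A;
       exists A : pos_op H,
         invertible_op A /\ opnorm (sigma A A) = opnorm A].
Proof.
have [M1 M2 _] := sigma_connection.
have [k k0 sk] := connection_diag_scalar sigma M1 M2 Hneq0.
have opnorm_id : opnorm (id_op : pos_op H) = 1 by rewrite opnorm_scalar.
have opnorm_diag A : opnorm (sigma A A) = complex.Re k * opnorm A.
  exact: opnorm_scale.
(* The supremum is attained at the pair [I], [I], since operators of norm 1 lie below [I]. *)
have norm_k : connection_norm sigma = (complex.Re k)%:E.
  apply/le_anti/andP; split.
    apply: ge_ereal_sup => _ [A [B [A1 B1 ->]]]; rewrite lee_fin.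
    have le1 (C : pos_op H) : opnorm C = 1 -> le_op C (id_op : pos_op H).
      move=> C1; have C0 : 0 <= (opnorm C)%:C%C by rewrite lecR opnorm_ge0.
      apply/le_opP => x; have /le_opP/(_ x) := le_scalar_opnorm C C0.
      by rewrite !scalar_opE C1.
    apply: (opnorm_le_scalar _ k k0); apply/le_opP => x.
    have /le_opP/(_ x) := M1 _ _ _ _ (le1 _ A1) (le1 _ B1).
    by rewrite sk id_opE.
  apply: ereal_sup_ubound; exists id_op, id_op; split => //.
  by rewrite opnorm_diag opnorm_id mulr1.
have k1_eq : complex.Re k = 1 -> k = 1.
  by move=> k1; rewrite -(RRe_real (ger0_real k0)) k1.
tfae.
- move=> [_ mean]; rewrite norm_k; congr EFin.
  by rewrite -[LHS]mulr1 -opnorm_id -opnorm_diag mean.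
- by rewrite norm_k => -[k1] A; rewrite opnorm_diag k1 mul1r.
- move=> E; exists id_op; split=> //.
  by exists id_op; split=> x; rewrite !id_opE.
(* Invertibility makes the norm of [A] nonzero, so it cancels and leaves [Re k = 1]. *)
- move=> [A [/(opnorm_invertible_neq0 Hneq0) A0]].
  rewrite opnorm_diag => /(canRL (mulfK A0)); rewrite mulfV // => /k1_eq k1.
  split=> // B; apply: pos_op_ext => x.
  by rewrite sk k1 scale1r.
Qed.
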